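(* Let $G$ be a topology-generating automaton with finite equivalence classes, with size smaller than a constant $C$. Let $\varphi:S\to X$ denote the address map onto the generated space, and let $X^n$, $n=1,2,\dots$, be the finite approximating spaces defined in the context. Then $X$ is (homeomorphic to) the compact Hausdorff space associated with the inverse limit $X^\infty$ of the spaces $X^n$.
   Context: Let $D=\{0,1,\dots,m-1\}$, and let $S=D^{\mathbb N}=D^\infty$ be the space of sequences (addresses) with the product topology. A topology-generating automaton $G=(V,D^2,E,o)$ is a finite directed graph with vertex set $V$ (states), edge set $E$ (loops and multiple edges allowed), each edge labelled by an element of $D^2$, and an initial state $o\in V$, such that: (1) each vertex has an outgoing edge and can be reached by a directed path from $o$; (2) no vertex has two outgoing edges with the same label; (3) to each state $c$ there is an 'inverse' state $c-$ such that for every edge from $b$ to $c$ labelled $(i,j)$ there is an edge from $b-$ to $c-$ labelled $(j,i)$, with $o-=o$ and $(c-)-=c$; (4) $o$ has loops with label $(i,i)$ for each $i\in D$. A pair of sequences is accepted if there is a directed path starting in $o$ whose successive edge labels are the successive pairs of symbols. Two addresses are equivalent, $s\sim t$, if they are related by the equivalence relation generated by the accepted pairs. The generated space is $X=S/{\sim}$ with the quotient topology and $\varphi:S\to X$ is the quotient map. Automata of complete $k$-tuple addresses. Let $K$ be the set of those $k\ge 2$ for which there is an equivalence class with exactly $k$ elements. For $k\in K$, $G_k$ is a finite directed graph with edges labelled by elements of $D^k$, an initial state $o$, and an outgoing edge at each vertex; a $k$-tuple $(s^1,\dots,s^k)$ of sequences is accepted by $G_k$ if there is an infinite directed path from $o$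 whose $n$-th edge has label $(s^1_n,\dots,s^k_n)$ for all $n$. It is assumed that every $k$-tuple accepted by $G_k$ consists of mutually equivalent addresses, and that every equivalence class with exactly $k$ elements, in a suitable order, is accepted by $G_k$. Approximations. For $k\in K$ and $n\ge1$ let $E_k^n$ be the set of directed paths of $n$ edges in $G_k$ starting in $o$. For $y\in E_k^n$ let $W_y\subset D^n$ be the set of the $k$ words of length $n$ which form the coordinates of the labels along the path. Let $E^n=\bigcup_{k\in K}E_k^n$ and $X^n=D^n\cup E^n$ (disjoint union), with the topology given by the following minimal open neighborhoods: $U(x)=\{x\}$ for $x\in D^n$; for $y\in E_k^n$, $U(y)$ consists of $y$, all $x\in W_y$, and all $z\in E_\ell^n$ with $\ell<k$ and $W_z\subset W_y$. Inverse limit. The projection $\pi_{n+1,n}:X^{n+1}\to X^n$ deletes the last symbol of a word in $D^{n+1}$ and the last edge of a path in $E_k^{n+1}$. The inverse limit $X^\infty$ is the set of sequences $(x^1,x^2,\dots)$ with $x^n\in X^n$ and $\pi_{n+1,n}(x^{n+1})=x^n$; equivalently $X^\infty=S\cup\bigcup_{k\in K}E_k^\infty$ with $E_k^\infty$ the set of infinite directed paths in $G_k$ starting in $o$. Its topology has at $x=(x^1,x^2,\dots)$ the neighborhood base $\pi_n^{-1}(U(x^n))$, $n=1,2,\dots$, where $\pi_n:X^\infty\to X^n$ is the projection $x\mapsto x^n$. The Hausdorff space associated with a topological space $Y$ is the quotient space $Y/{\equiv}$, where $x\equiv y$ if $f(x)=f(y)$ for every continuous real-valued function $f$ on $Y$.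 *)

(* Defs.v *)
From HB Require Import structures.
From Stdlib Require Import Relations.
From mathcomp Require Import all_boot all_algebra.
From mathcomp Require Import all_classical all_reals all_analysis.

Set Implicit Arguments.
Unset Strict Implicit.
Unset Printing Implicit Defensive.

Import numFieldTopology.Exports.

Local Open Scope quotient_scope.
Local Open Scope classical_set_scope.
Local Open Scope card_scope.

(** Finite directed graphs, possibly with loops and multiple edges, with edges
    labelled by elements of [L] and with an initial state. *)
Record lgraph (L : Type) := LGraph {
  state : finType;
  edge : finType;
  src : edge -> state;
  tgt : edge -> state;
  lab : edge -> L;
  init : state }.

Section Graphs.
Context {L : Type} (G : lgraph L).

Fixpoint path_from (v : state G) (p : seq (edge G)) : bool :=
  if p is e :: p' then (src e == v) && path_from (tgt e) p' else true.

Definition reachable (v : state G) : Prop :=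
  exists2 p : seq (edge G),
    path_from (init G) p & last (init G) (map (@tgt L G) p) = v.

Definition infinite_path (p : nat -> edge G) : Prop :=
  src (p 0) = init G /\ forall n, src (p n.+1) = tgt (p n).

Definition accepts (w : nat -> L) : Prop :=
  exists2 p, infinite_path p & forall n, lab (p n) = w n.

Definition outgoing : Prop := forall v : state G, exists e : edge G, src e = v.

Lemma path_from_take v n p : path_from v p -> path_from v (take n p).
Proof.
elim: p v n => [|e p IH] v [|n] //= /andP[-> pp] /=.
exact: IH.
Qed.

End Graphs.

Definition generating_automaton m (G : lgraph ('I_m * 'I_m)) : Prop :=
  [/\ outgoing G /\ (forall v : state G, reachable v),
      (forall e e' : edge G, src e = src e' -> lab e = lab e' -> e = e'),
      (exists inv : state G -> state G,
        [/\ inv (init G) = init G,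
            (forall c, inv (inv c) = c) &
            forall e : edge G, exists e' : edge G,
              [/\ src e' = inv (src e), tgt e' = inv (tgt e) &
                  lab e' = ((lab e).2, (lab e).1)]]) &
      forall i : 'I_m, exists e : edge G,
        [/\ src e = init G, tgt e = init G & lab e = (i, i)]].

Definition addr (m : nat) : topologicalType :=
  prod_topology (fun _ : nat => discrete_topology 'I_m).

Section EquivalenceOfAProp.
Context {T : choiceType} (r : T -> T -> Prop) (er : equivalence T r).

Let rb (x y : T) : bool := `[< r x y >].

Let rb_refl : reflexive rb.
Proof. by case: er => refl _ _ x; apply/asboolP; exact: refl. Qed.

Let rb_sym : symmetric rb.
Proof. by case: er => _ _ sym x y; apply/asboolP/asboolP; exact: sym. Qed.

Let rb_trans : transitive rb.
Proof.
case: er => _ trans _ y x z /asboolP xy /asboolP yz.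
by apply/asboolP; exact: trans xy yz.
Qed.

Definition prop_equiv : equiv_rel T := EquivRel rb rb_refl rb_sym rb_trans.

End EquivalenceOfAProp.

Section GeneratedSpace.
Context {m : nat} (G : lgraph ('I_m * 'I_m)).

Definition accepted_pair (s t : addr m) : Prop :=
  accepts G (fun n => (s n, t n)).

Definition addr_sim : addr m -> addr m -> Prop :=
  clos_refl_sym_trans (addr m) accepted_pair.

Definition addr_class (s : addr m) : set (addr m) := [set t | addr_sim s t].

Definition addr_equiv : equiv_rel (addr m) :=
  prop_equiv (clos_rst_is_equiv (addr m) accepted_pair).

Definition generated_space : topologicalType :=
  quotient_topology {eq_quot addr_equiv}.

Definition address_map : addr m -> generated_space :=
  \pi_(quotient_topology {eq_quot addr_equiv}).

(** The set [K] of the sizes [k >= 2] of equivalence classes. *)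
Definition class_sizes : set nat :=
  [set k | (2 <= k)%N /\ exists s, addr_class s #= `I_k].

End GeneratedSpace.

Section Approximation.
Context {m : nat} {G : lgraph ('I_m * 'I_m)}.
Variable Gk : forall k : class_sizes G, lgraph ((val k).-tuple 'I_m).

Definition accepted_tuple (k : class_sizes G) (s : 'I_(val k) -> addr m) :=
  accepts (Gk k) (fun n => [tuple s i n | i < val k]).

Definition complete_tuple_automata : Prop :=
  forall k : class_sizes G,
    [/\ outgoing (Gk k),
        (forall s : 'I_(val k) -> addr m,
           accepted_tuple s -> forall i j, addr_sim G (s i) (s j)) &
        (forall t : addr m, addr_class G t #= `I_(val k) ->
           exists s : 'I_(val k) -> addr m,
             [/\ injective s, range s = addr_class G t & accepted_tuple s])].

(** [E_k^n] *)
Definition fin_path (k : class_sizes G) (n : nat) : choiceType :=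
  {p : n.-tuple (edge (Gk k)) | path_from (init (Gk k)) p}.

(** [W_y], for [y] a path in [E_k^n] *)
Definition path_words k n (p : fin_path k n) : set (n.-tuple 'I_m) :=
  range (fun i : 'I_(val k) => [tuple tnth (lab (tnth (val p) j)) i | j < n]).

Definition approx_space (n : nat) : Type :=
  (n.-tuple 'I_m + {k : class_sizes G & fin_path k n})%type.

HB.instance Definition _ n := Choice.on (approx_space n).

Definition word_pt n (w : n.-tuple 'I_m) : approx_space n := inl w.

Definition path_pt n k (p : fin_path k n) : approx_space n :=
  inr (existT (fun k => fin_path k n) k p).

(** [U(x)] *)
Definition min_nbhs n (x : approx_space n) : set (approx_space n) :=
  match x with
  | inl w => [set word_pt w]
  | inr (existT k p) =>
      [set path_pt p] `|`
      [set word_pt w | w in path_words p] `|`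
      [set z | exists l (q : fin_path l n),
         [/\ z = path_pt q, (val l < val k)%N &
             path_words q `<=` path_words p]]
  end.

Lemma min_nbhs_refl n (x : approx_space n) : min_nbhs x x.
Proof. by case: x => [w|[k p]] //=; left; left. Qed.

Lemma min_nbhs_trans n (x y : approx_space n) :
  min_nbhs x y -> min_nbhs y `<=` min_nbhs x.
Proof.
case: x => [w /= -> //|[k p]] /= [[-> //|[w pw <-] z /= ->]|].
  by left; right; exists w.
move=> [l [q [-> lk qp]]] z [[->|[w qw <-]]|].
- by right; exists l, q.
- by left; right; exists w => //; exact: qp.
- move=> [j [r [-> jl rq]]]; right; exists j, r; split => //.
    exact: ltn_trans lk.
  exact: subset_trans qp.
Qed.

Let approx_nbhs n (x : approx_space n) : set (set (approx_space n)) :=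
  [set A | min_nbhs x `<=` A].

Let approx_nbhs_filter n (x : approx_space n) : ProperFilter (approx_nbhs x).
Proof.
split; first by move=> /(_ x (min_nbhs_refl x)).
split=> [//|A B xA xB z xz|A B AB xA z xz].
- by split; [exact: xA|exact: xB].
- by apply: AB; exact: xA.
Qed.

Let approx_nbhs_singleton n (x : approx_space n) (A : set (approx_space n)) :
  approx_nbhs x A -> A x.
Proof. by apply; exact: min_nbhs_refl. Qed.

Let approx_nbhs_nbhs n (x : approx_space n) (A : set (approx_space n)) :
  approx_nbhs x A -> approx_nbhs x (@approx_nbhs n ^~ A).
Proof. by move=> xA y xy z yz; apply: xA; exact: (min_nbhs_trans xy). Qed.

HB.instance Definition _ n := hasNbhs.Build (approx_space n) (@approx_nbhs n).

HB.instance Definition _ n := Nbhs_isNbhsTopological.Build (approx_space n)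
  (@approx_nbhs_filter n) (@approx_nbhs_singleton n) (@approx_nbhs_nbhs n).

Definition trunc_tuple T n (t : n.+1.-tuple T) : n.-tuple T :=
  [tuple tnth t (widen_ord (leqnSn n) i) | i < n].

Lemma truncE T n (t : n.+1.-tuple T) : trunc_tuple t = take n t :> seq T.
Proof.
have x0 := tnth t ord0.
apply: (@eq_from_nth _ x0) => [|i].
  by rewrite size_tuple size_takel // size_tuple.
rewrite size_tuple => ltin.
rewrite nth_take // -(tnth_nth x0 _ (Ordinal ltin)) tnth_mktuple.
by rewrite (tnth_nth x0).
Qed.

Lemma trunc_path k n (p : fin_path k n.+1) :
  path_from (init (Gk k)) (trunc_tuple (val p)).
Proof. by rewrite truncE; apply: path_from_take; exact: valP p. Qed.

Definition path_trunc k n (p : fin_path k n.+1) : fin_path k n :=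
  exist _ (trunc_tuple (val p)) (trunc_path p).

(** [pi_(n+1,n)] *)
Definition approx_proj n (x : approx_space n.+1) : approx_space n :=
  match x with
  | inl w => word_pt (trunc_tuple w)
  | inr (existT k p) => path_pt (path_trunc p)
  end.

Lemma path_words_trunc k n (p : fin_path k n.+1) :
  path_words (path_trunc p) = @trunc_tuple _ n @` path_words p.
Proof.
rewrite /path_words image_comp; apply: eq_imagel => i _ /=.
by apply: eq_from_tnth => j; rewrite !tnth_mktuple.
Qed.

Lemma approx_proj_min_nbhs n (x y : approx_space n.+1) :
  min_nbhs x y -> min_nbhs (approx_proj x) (approx_proj y).
Proof.
case: x => [w /= -> //|[k p]] /= [[-> |[w pw <-]]|].
- by left; left.
- left; right; exists (trunc_tuple w) => //.
  by rewrite path_words_trunc; exists w.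
- move=> [l [q [-> lk qp]]]; right; exists l, (path_trunc q); split => //.
  by rewrite !path_words_trunc; exact: image_subset.
Qed.

Lemma approx_proj_continuous n : continuous (@approx_proj n).
Proof.
move=> x A.
change (approx_nbhs (approx_proj x) A ->
        approx_nbhs x (@approx_proj n @^-1` A)).
by move=> xA y xy; apply: xA; exact: approx_proj_min_nbhs.
Qed.

(** The index [n] of a point of the inverse limit stands for the level [n+1],
    since the approximating spaces are numbered from 1. *)
Definition inverse_limit : Type :=
  [set x : forall n, approx_space n.+1 | forall n, approx_proj (x n.+1) = x n].

HB.instance Definition _ := Choice.on inverse_limit.

Definition limit_proj n (x : inverse_limit) : approx_space n.+1 := val x n.

Let limit_base (x : inverse_limit) (n : nat) : set inverse_limit :=
  limit_proj n @^-1` min_nbhs (limit_proj n x).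

Let limit_nbhs (x : inverse_limit) : set (set inverse_limit) :=
  filter_from setT (limit_base x).

Lemma limit_projE n (x : inverse_limit) :
  approx_proj (limit_proj n.+1 x) = limit_proj n x.
Proof. by have /set_mem := valP x; exact. Qed.

Let limit_base_decr (x : inverse_limit) n k :
  limit_base x (n + k) `<=` limit_base x n.
Proof.
elim: k => [|k IH]; first by rewrite addn0.
apply: subset_trans IH => y; rewrite addnS /limit_base /=.
by move=> /approx_proj_min_nbhs; rewrite !limit_projE.
Qed.

Let limit_nbhs_filter (x : inverse_limit) : ProperFilter (limit_nbhs x).
Proof.
apply: filter_from_proper => [|n _]; last by exists x; exact: min_nbhs_refl.
apply: filter_from_filter => [|i j _ _]; first by exists 0.
exists (i + j) => // y yij; split; first exact: limit_base_decr yij.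
by apply: limit_base_decr; rewrite addnC; exact: yij.
Qed.

Let limit_nbhs_singleton (x : inverse_limit) (A : set inverse_limit) :
  limit_nbhs x A -> A x.
Proof. by move=> [n _]; apply; exact: min_nbhs_refl. Qed.

Let limit_nbhs_nbhs (x : inverse_limit) (A : set inverse_limit) :
  limit_nbhs x A -> limit_nbhs x (limit_nbhs^~ A).
Proof.
move=> [n _ nA]; exists n => // y xy; exists n => // z yz.
by apply: nA; exact: (min_nbhs_trans xy).
Qed.

HB.instance Definition _ := hasNbhs.Build inverse_limit limit_nbhs.

HB.instance Definition _ := Nbhs_isNbhsTopological.Build inverse_limit
  limit_nbhs_filter limit_nbhs_singleton limit_nbhs_nbhs.

End Approximation.

Section AssociatedHausdorffSpace.
Context (R : realType) (Y : topologicalType).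

Definition fun_sim (x y : Y) : Prop :=
  forall f : Y -> R, continuous f -> f x = f y.

Lemma fun_sim_equivalence : equivalence Y fun_sim.
Proof.
split=> [x f //|x y z xy yz f cf|x y xy f cf].
- by rewrite (xy f cf) (yz f cf).
- by rewrite (xy f cf).
Qed.

Definition hausdorff_quotient : topologicalType :=
  quotient_topology {eq_quot (prop_equiv fun_sim_equivalence)}.

End AssociatedHausdorffSpace.

Definition homeomorphic (X Y : topologicalType) : Prop :=
  exists (f : X -> Y) (g : Y -> X),
    [/\ cancel f g, cancel g f, continuous f & continuous g].

(* Main.v *)
From Stdlib Require Import Relations.
Require Import Defs.
From mathcomp Require Import all_boot all_algebra.
From mathcomp Require Import all_classical all_reals all_analysis.

Set Implicit Arguments.
Unset Strict Implicit.
Unset Printing Implicit Defensive.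

Import GRing.Theory numFieldTopology.Exports.

Local Open Scope quotient_scope.
Local Open Scope classical_set_scope.
Local Open Scope card_scope.

(** Write [S] for the address space, [X] for the generated space, [phi] for the
    address map and [Xoo] for the inverse limit.  The proof compares [Xoo] with
    [X] through two maps, the inclusion [S -> Xoo] of the sequences
    ([word_limit]) and a map [F : Xoo -> X] extending [phi]
    ([limit_to_generated]).

    Call [s] an address of a point [x] of [Xoo] if at every level the initial
    word of [s] is one of the words of the approximation of [x].  A sequence has
    itself as its only address; an infinite path in [G_k] has its [k] coordinate
    sequences as addresses, and these are equivalent; [F] sends it to their
    common class.  This [F] is continuous: an open set
    of [X] around [F x] contains the images of small cylinders around the
    finitely many coordinates of [x], and every point close to [x] has an
    address in one of these cylinders.

    Every neighbourhood of [x] contains each address of [x], so a continuous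
    function from [Xoo] to a Hausdorff space takes equal values at [x] and at
    its addresses ([address_of_limit]).  Two different equivalent addresses lie
    in a class with exactly [k >= 2] elements, and completeness of [G_k] yields
    a path having both as addresses ([sim_common_point]).  Hence real functions
    on [Xoo] cannot separate points with equal images under [F].

    Conversely points of [X] are separated by real functions, which pull back
    along [F].  For this, [phi] is shown to be a closed map: accepted pairs form
    a compact set, so the set of addresses related by an accepted pair to a
    closed set is closed, and since classes have fewer than [C] elements the
    saturation of a closed set is reached in [C] such steps
    ([saturation_closed]).  A closed continuous image of the compact Hausdorff
    space [S] is normal, and Urysohn's lemma applies
    ([generated_space_separation]).

    Thus [F] and [S -> Xoo] induce mutually inverse continuous maps between the
    associated Hausdorff space of [Xoo] and [X].  The former is compact as an
    image of [S], and Hausdorff because real functions separate its points. *)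

(** * Initial segments of sequences *)

Definition initial_tuple T n (s : nat -> T) : n.-tuple T := [tuple s i | i < n].

Lemma initial_tupleP T n (s t : nat -> T) :
  initial_tuple n s = initial_tuple n t <-> forall i, (i < n)%N -> s i = t i.
Proof.
split=> [st i ltin|st].
  have /(congr1 (fun u => tnth u (Ordinal ltin))) := st.
  by rewrite !tnth_mktuple.
by apply: eq_from_tnth => i; rewrite !tnth_mktuple; exact: st.
Qed.

Lemma initial_tupleE T n (s : nat -> T) :
  initial_tuple n s = [seq s i | i <- iota 0 n] :> seq T.
Proof. by rewrite -val_enum_ord -map_comp. Qed.

Lemma trunc_initial_tuple T n (s : nat -> T) :
  trunc_tuple (initial_tuple n.+1 s) = initial_tuple n s.
Proof. by apply: eq_from_tnth => i; rewrite !tnth_mktuple. Qed.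

(** Used twice, for the words and for the paths of a point of the inverse limit;
    the sequence collects the last entries of the tuples. *)
Lemma coherent_tuples T (u : forall n, n.+1.-tuple T) :
  (forall n, trunc_tuple (u n.+1) = u n) ->
  exists s : nat -> T, forall n, u n = initial_tuple n.+1 s.
Proof.
move=> uP; exists (fun n => tnth (u n) ord_max) => n; apply: eq_from_tnth.
elim: n => [|n IH] i; rewrite tnth_mktuple.
  by have -> : i = ord_max by rewrite [i]ord1; exact: val_inj.
case: (ltnP i n.+1) => [ltin|leni].
  rewrite (_ : i = widen_ord (leqnSn n.+1) (Ordinal ltin)); last exact: val_inj.
  have := IH (Ordinal ltin); rewrite tnth_mktuple /= => <-.
  by rewrite -(uP n) tnth_mktuple.
have -> // : i = ord_max.
by apply/val_inj/eqP; rewrite eqn_leq leni -ltnS ltn_ord.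
Qed.

Lemma path_from_iota L (G : lgraph L) (p : nat -> edge G) v a n :
  path_from v [seq p i | i <- iota a n.+1] <->
  src (p a) = v /\
  forall i, (a <= i < a + n)%N -> src (p i.+1) = tgt (p i).
Proof.
elim: n v a => [|n IH] v a.
  rewrite /= andbT; split=> [/eqP -> |[-> _]//]; split=> // i.
  by rewrite addn0 => /andP[/leq_ltn_trans h /h]; rewrite ltnn.
have -> : path_from v [seq p i | i <- iota a n.+2] =
  (src (p a) == v) && path_from (tgt (p a)) [seq p i | i <- iota a.+1 n.+1].
  by [].
split=> [/andP[/eqP -> /IH[pa pP]]|[pa pP]].
  split=> // i; rewrite leq_eqVlt => /andP[/orP[/eqP <- //|ai] ib].
  by apply: pP; rewrite ai addSnnS.
apply/andP; split; first exact/eqP.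
apply/IH; split=> [|i /andP[ai ib]].
  by apply: pP; rewrite leqnn addnS ltnS leq_addr.
by apply: pP; rewrite ltnW // -addSnnS.
Qed.

Lemma infinite_pathP L (G : lgraph L) (p : nat -> edge G) :
  infinite_path p <-> forall n, path_from (init G) (initial_tuple n.+1 p).
Proof.
split=> [[p0 pS] n|pP].
  by rewrite initial_tupleE; apply/path_from_iota; split=> // i _; exact: pS.
split=> [|n].
  by have := pP 0; rewrite initial_tupleE => /path_from_iota[].
have := pP n.+1; rewrite initial_tupleE => /path_from_iota[_]; apply.
by rewrite add0n ltnSn.
Qed.

(** * Sequence spaces over a discrete alphabet *)

(** The addresses form such a space, and so do the edge sequences of a finite
    graph. *)
Definition seq_space (T : choiceType) : topologicalType :=
  prod_topology (fun _ : nat => discrete_topology T).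

Lemma coordinate_continuous (T : choiceType) n :
  continuous (fun s : seq_space T => s n : discrete_topology T).
Proof. exact: (@proj_continuous nat (fun=> discrete_topology T) n). Qed.

Lemma nbhs_cylinder (T : choiceType) (s : seq_space T) n :
  nbhs s [set t : seq_space T | initial_tuple n t = initial_tuple n s].
Proof.
have eval_s (i : 'I_n) : nbhs s [set t : seq_space T | t i = s i].
  apply: (@coordinate_continuous T i s [set x | x = s i]).
  exact: (@discrete_set1 (discrete_topology T) (s i)).
have FF : Filter (nbhs s) by exact: nbhs_filter.
have all_s := @filter_forall _ _ _ (nbhs s) FF eval_s.
apply: (@filterS _ (nbhs s) FF _ _ _ all_s) => t ts.
by apply/initial_tupleP => i ltin; exact: (ts (Ordinal ltin)).
Qed.

Lemma cvg_seq_space (T : choiceType) (F : set_system (seq_space T))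
    (s : seq_space T) : Filter F ->
  (forall n, F [set t | t n = s n]) -> F --> s.
Proof.
move=> FF Fs; apply/cvg_sup => n U [V] [[W oW <-] Wsn WU].
by apply: filterS (Fs n) => t /= tsn; apply: WU; rewrite /= /proj tsn.
Qed.

(** The filter generated by the cylinders around [s] converges to [s]
    coordinatewise, hence is finer than the neighbourhood filter. *)
Lemma cylinder_basis (T : choiceType) (s : seq_space T) A : nbhs s A ->
  exists n, forall t : seq_space T,
    initial_tuple n t = initial_tuple n s -> A t.
Proof.
pose cyl n : set (seq_space T) :=
  [set t | initial_tuple n t = initial_tuple n s].
have FF : Filter (filter_from setT cyl).
  apply: filter_from_filter; first by exists 0.
  move=> i j _ _; exists (maxn i j) => // t /initial_tupleP ts; split;
    by apply/initial_tupleP => l li; apply: ts; rewrite leq_max li ?orbT.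
have FS : filter_from setT cyl --> s.
  apply: cvg_seq_space => n; exists n.+1 => // t /initial_tupleP; apply.
  exact: ltnSn.
by move=> /FS[n _ nA]; exists n.
Qed.

Lemma seq_space_hausdorff (T : choiceType) : hausdorff_space (seq_space T).
Proof. by apply: hausdorff_product => _; exact: discrete_hausdorff. Qed.

Lemma seq_space_compact (T : finType) : compact [set: seq_space T].
Proof.
have := @tychonoff nat (fun=> discrete_topology T) (fun=> setT).
rewrite (_ : [set f | _] = setT); last by apply/seteqP; split.
by apply=> _; exact/finite_compact/finite_finset.
Qed.

Lemma coordinate_closed (T : choiceType) n (A : set T) :
  closed [set s : seq_space T | A (s n)].
Proof.
apply: (@preimage_closed (seq_space T) (discrete_topology T) (fun s => s n) A).
  by move=> s _; exact: coordinate_continuous.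
exact: discrete_closed.
Qed.

Lemma seq_space_continuous (X : topologicalType) (T : choiceType)
    (f : X -> seq_space T) :
  (forall n, continuous (fun x => f x n : discrete_topology T)) -> continuous f.
Proof.
move=> fc x; apply: cvg_seq_space => n.
apply: (fc n x [set y | y = f x n]).
exact: (@discrete_set1 (discrete_topology T) (f x n)).
Qed.

Lemma map_seq_continuous (T U : choiceType) (h : T -> U) :
  continuous (fun s : seq_space T => (fun n => h (s n)) : seq_space U).
Proof.
apply: seq_space_continuous => n s A.
move=> /(@nbhs_singleton (discrete_topology U)) Ahs.
apply: (@coordinate_continuous T n s (h @^-1` A)).
apply: (@open_nbhs_nbhs (discrete_topology T)); split; last exact: Ahs.
exact: discrete_open.
Qed.

Lemma infinite_paths_closed L (G : lgraph L) :
  closed [set p : seq_space (edge G) | infinite_path p].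
Proof.
have -> : [set p : seq_space (edge G) | infinite_path p] =
    [set p | src (p 0) = init G] `&`
    \bigcap_n \bigcap_e
      ([set p | p n <> e] `|` [set p | src (p n.+1) = tgt e]).
  apply/seteqP; split=> [p [p0 pS]|p [p0 pS]]; split=> // n.
    by move=> _ e _; have [<-|ne] := EM (p n = e); [right; exact: pS|left].
  by case: (pS n I (p n) I).
apply: closedI; first exact: (@coordinate_closed _ 0 [set e | src e = init G]).
apply: closed_bigI => n _; apply: closed_bigI => e _; apply: closedU.
  exact: (@coordinate_closed _ n [set e' | e' <> e]).
exact: (@coordinate_closed _ n.+1 [set e' | src e' = tgt e]).
Qed.

(** * Closed maps, normality and separation by real functions *)

Lemma pair_continuous (X Y Z : topologicalType) (f : X -> Y) (g : X -> Z) :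
  continuous f -> continuous g -> continuous (fun x => (f x, g x)).
Proof. by move=> fc gc x; exact: cvg_pair (fc x) (gc x). Qed.

(** The image is the second projection of the compact set
    [A `&` (F `*` setT)]. *)
Lemma compact_relation_image (X : topologicalType) (A : set (X * X))
    (F : set X) :
  hausdorff_space X -> compact A -> closed F ->
  closed [set y | exists2 x, F x & A (x, y)].
Proof.
move=> hX cA cF.
have -> : [set y | exists2 x, F x & A (x, y)] = snd @` (A `&` fst @^-1` F).
  apply/seteqP; split=> [y [x Fx Axy]|y [[x z] [Axz Fx] <-]]; last by exists x.
  by exists (x, y).
apply: compact_closed => //; apply: continuous_compact.
  by apply: continuous_subspaceT => x; exact: cvg_snd.
apply: compact_closedI => //.
by apply: preimage_closed => // x _; exact: cvg_fst.
Qed.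

(** Disjoint open sets around the preimages of [A] and [B] are pushed forward as
    complements of the images of their complements. *)
Lemma closed_map_normal (R : realType) (X Y : topologicalType) (f : X -> Y) :
  continuous f -> (forall y, exists x, f x = y) ->
  (forall F, closed F -> closed (f @` F)) ->
  normal_space X -> normal_space Y.
Proof.
move=> fc fs fF /(@normal_openP R) nX; apply/(@normal_openP R) => A B cA cB AB0.
have [||| U [V [oU oV AU BV UV0]]] := nX (f @^-1` A) (f @^-1` B).
- by apply: preimage_closed => // x _; exact: fc.
- by apply: preimage_closed => // x _; exact: fc.
- by rewrite -preimage_setI AB0 preimage_set0.
exists (~` (f @` ~` U)), (~` (f @` ~` V)); split.
- exact/closed_openC/fF/open_closedC.
- exact/closed_openC/fF/open_closedC.
- by move=> y Ay [x Ux fxy]; apply: Ux; apply: AU; rewrite /= fxy.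
- by move=> y By [x Vx fxy]; apply: Vx; apply: BV; rewrite /= fxy.
apply/seteqP; split=> // y [yU yV]; have [x fxy] := fs y.
have Ux : U x by apply: contrapT => nUx; apply: yU; exists x.
have Vx : V x by apply: contrapT => nVx; apply: yV; exists x.
by have : (U `&` V) x by []; rewrite UV0.
Qed.

Lemma normal_function_separation (R : realType) (X : topologicalType)
    (x y : X) :
  normal_space X -> closed [set x] -> closed [set y] -> x <> y ->
  exists2 f : X -> R, continuous f & f x <> f y.
Proof.
move=> nX cx cy xy.
have : uniform_separator [set x] [set y].
  apply: (@normal_uniform_separator _ nX) => //.
  by apply/seteqP; split=> // z [/= -> /xy].
move=> /(@uniform_separatorP _ R)[f [fc _ f0 f1]]; exists f => //.
have -> : f x = 0%R by apply: f0; exists x.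
have -> : f y = 1%R by apply: f1; exists y.
by move=> /esym/eqP; rewrite oner_eq0.
Qed.

(** * The generated space *)

Lemma card_uniq_in_set (T : choiceType) (A : set T) k (q : seq T) :
  A #= `I_k -> uniq q -> {in q, forall x, A x} -> (size q <= k)%N.
Proof.
move=> Ak uq qA.
have finA : finite_set A by apply/finite_setP; exists k.
rewrite -(card_fset_set Ak); apply: (uniq_leq_size uq) => x xq.
by rewrite in_fset_set // inE; exact: qA.
Qed.

Section GeneratedSpaceSeparation.
Context {m : nat} (G : lgraph ('I_m * 'I_m)).

(** The accepted pairs are the labels of infinite paths, and infinite paths form
    a closed subset of the compact space of edge sequences.  This replaces the
    usual appeal to Koenig's lemma. *)
Lemma accepted_pairs_compact :
  compact [set st : addr m * addr m | accepted_pair G st.1 st.2].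
Proof.
pose f (p : seq_space (edge G)) : addr m * addr m :=
  (fun n => (lab (p n)).1, fun n => (lab (p n)).2).
have -> : [set st : addr m * addr m | accepted_pair G st.1 st.2] =
    f @` [set p : seq_space (edge G) | infinite_path p].
  apply/seteqP; split=> [[s t] [p pP pw]|_ [p pP <-]].
    by exists p => //; congr pair; apply: funext => n; rewrite pw.
  by exists p => // n; rewrite -surjective_pairing.
have fc : continuous f.
  apply: (@pair_continuous (seq_space (edge G)) (addr m) (addr m)).
    exact: (@map_seq_continuous _ _ (fun e : edge G => (lab e).1)).
  exact: (@map_seq_continuous _ _ (fun e : edge G => (lab e).2)).
apply: (@continuous_compact (seq_space (edge G))).
  exact: (continuous_subspaceT fc).
apply: (subclosed_compact _ (@seq_space_compact (edge G))) => //.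
exact: infinite_paths_closed.
Qed.

Lemma address_map_eq s t : address_map G s = address_map G t <-> addr_sim G s t.
Proof.
by split=> [/(@eqmodP _ (addr_equiv G))/asboolP //|st];
  apply/(@eqmodP _ (addr_equiv G))/asboolP.
Qed.

Lemma address_map_continuous : continuous (address_map G).
Proof. exact: pi_continuous. Qed.

Lemma address_map_surj (x : generated_space G) : exists s, address_map G s = x.
Proof. by exists (repr x); rewrite /address_map reprK. Qed.

Context (autG : generating_automaton G).

Lemma accepted_pair_refl s : accepted_pair G s s.
Proof.
have [_ _ _ loops] := autG.
have [e eP] := choice (fun n => loops (s n)).
exists e => [|n]; last by have [] := eP n.
split=> [|n]; first by have [] := eP 0.
by have [_ -> _] := eP n; have [-> _ _] := eP n.+1.
Qed.

Lemma accepted_pair_sym s t : accepted_pair G s t -> accepted_pair G t s.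
Proof.
move=> [p [p0 pS] pst]; have [_ _ [inv [inv0 _ invE]] _] := autG.
have [q qP] := choice invE.
exists (q \o p) => [|n]; last by have [_ _ ->] := qP (p n); rewrite pst.
split=> [|n] /=; first by have [-> _ _] := qP (p 0); rewrite p0.
by have [-> _ _] := qP (p n.+1); have [_ -> _] := qP (p n); rewrite pS.
Qed.

(* A boolean copy, so that chains of accepted pairs are [path]s and can be made
   free of repetitions by [shortenP]. *)
Let accepted_pairb (s t : addr m) : bool := `[< accepted_pair G s t >].

Lemma addr_sim_path s t :
  addr_sim G s t -> exists2 p, path accepted_pairb s p & t = last s p.
Proof.
elim=> [x y xy|x|x y _ [p px ->]|x y z _ [p px ->] _ [q qx ->]].
- by exists [:: y]; rewrite //= andbT; apply/asboolP.
- by exists [::].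
- exists (rev (belast x p)).
    rewrite rev_path; apply: sub_path px => u v /asboolP uv.
    by apply/asboolP; exact: accepted_pair_sym.
  by case: p px => //= a p _; rewrite rev_cons last_rcons.
- by exists (p ++ q); rewrite ?cat_path ?px ?last_cat.
Qed.

Lemma path_addr_sim s p :
  path accepted_pairb s p -> {in s :: p, forall t, addr_sim G s t}.
Proof.
elim: p s => [|x p IH] s.
  by move=> _ t; rewrite inE => /eqP ->; exact: rst_refl.
move=> /= /andP[/asboolP sx xp] t; rewrite inE => /orP[/eqP ->|tp].
  exact: rst_refl.
apply: rst_trans (IH _ xp _ tp); exact: rst_step.
Qed.

Definition successors (F : set (addr m)) : set (addr m) :=
  [set t | exists2 s, F s & accepted_pair G s t].

Lemma subset_successors F : F `<=` successors F.
Proof. by move=> s Fs; exists s => //; exact: accepted_pair_refl. Qed.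

Lemma successors_closed F : closed F -> closed (successors F).
Proof.
exact: (compact_relation_image (@seq_space_hausdorff _) accepted_pairs_compact).
Qed.

Lemma iter_successors_path n F s p :
  F s -> path accepted_pairb s p -> (size p <= n)%N ->
  iter n successors F (last s p).
Proof.
elim: n F s p => [|n IH] F s [|x p] //= Fs.
  by move=> _ _; apply: subset_successors; exact: (IH _ _ [::]).
move=> /andP[/asboolP sx xp] ltpn; rewrite -iterS iterSr.
by apply: IH xp _ => //; exists s.
Qed.

Lemma iter_successors_sim n (F : set (addr m)) t :
  iter n successors F t -> exists2 s, F s & addr_sim G s t.
Proof.
elim: n t => [|n IH] t /=; first by exists t => //; exact: rst_refl.
move=> [u /IH[s Fs su] ut]; exists s => //.
by apply: rst_trans su _; exact: rst_step.
Qed.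

Context {C : nat}.
Context (finC :
  forall s : addr m, exists2 k : nat, (k < C)%N & addr_class G s #= `I_k).

(** Equivalent addresses are joined by a chain of accepted pairs without
    repetitions.  It stays in one class, so it has fewer than [C] members; the
    saturation is therefore the [C]-fold iterate of [successors]. *)
Lemma saturation_closed (F : set (addr m)) :
  closed F -> closed [set t | exists2 s, F s & addr_sim G s t].
Proof.
move=> cF.
suff -> : [set t | exists2 s, F s & addr_sim G s t] = iter C successors F.
  by elim: C => //= n IH; exact: successors_closed.
apply/seteqP; split=> t; last exact: iter_successors_sim.
move=> [s Fs /addr_sim_path[p sp ->]]; case/shortenP: sp => q sq uq _.
have [k ltkC sk] := finC s.
apply: (iter_successors_path Fs sq); apply: leq_trans (ltnW ltkC).
exact: ltnW (card_uniq_in_set sk uq (path_addr_sim sq)).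
Qed.

Lemma address_map_closed F : closed F -> closed (address_map G @` F).
Proof.
move=> cF; rewrite -openC.
(* In the quotient topology a set is open when its preimage is. *)
change (open (~` (address_map G @^-1` (address_map G @` F)))); rewrite openC.
have -> : address_map G @^-1` (address_map G @` F) =
    [set t | exists2 s, F s & addr_sim G s t]; last exact: saturation_closed cF.
apply/seteqP; split=> t; first by move=> [s Fs /address_map_eq st]; exists s.
by move=> [s Fs st]; exists s => //; exact/address_map_eq.
Qed.

(** Urysohn's lemma, as the address map makes the generated space a closed image
    of a compact Hausdorff space. *)
Lemma generated_space_separation (R : realType) (x y : generated_space G) :
  x <> y -> exists2 f : generated_space G -> R, continuous f & f x <> f y.
Proof.
have cl1 (z : generated_space G) : closed [set z].
  have [s <-] := address_map_surj z; rewrite -image_set1.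
  apply: address_map_closed; apply: compact_closed.
    exact: seq_space_hausdorff.
  exact: compact_set1.
apply: normal_function_separation => //.
apply: (closed_map_normal R address_map_continuous address_map_surj
          address_map_closed).
by apply: compact_normal; [exact: seq_space_hausdorff|exact: seq_space_compact].
Qed.

End GeneratedSpaceSeparation.

(** * Points of the inverse limit and their addresses *)

Section InverseLimit.
Context {m : nat} {G : lgraph ('I_m * 'I_m)}.
Context (Gk : forall k : class_sizes G, lgraph ((val k).-tuple 'I_m)).

(** [W_y] for a path, extended to words so that points of both kinds are treated
    alike. *)
Definition point_words n (x : approx_space Gk n) : set (n.-tuple 'I_m) :=
  match x with
  | inl w => [set w]
  | inr (existT k p) => path_words p
  end.

Lemma min_nbhs_words n (x z : approx_space Gk n) :
  min_nbhs x z -> point_words z `<=` point_words x.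
Proof.
case: x => [w -> //|[k p]] /= [[-> //|[w pw <-] _ -> //]|].
by move=> [l [q [-> _]]].
Qed.

Lemma min_nbhs_word_pt n (x : approx_space Gk n) w :
  point_words x w -> min_nbhs x (word_pt Gk w).
Proof. by case: x => [w' -> //|[k p]] /= pw; left; right; exists w. Qed.

Lemma word_limit_subproof (s : addr m) :
  (fun n => word_pt Gk (initial_tuple n.+1 s)) \in
  [set x : forall n, approx_space Gk n.+1 |
    forall n, approx_proj (x n.+1) = x n].
Proof. by apply/mem_set => n /=; rewrite trunc_initial_tuple. Qed.

Definition word_limit (s : addr m) : inverse_limit Gk :=
  exist (fun x => x \in _) _ (word_limit_subproof s).

Section PathLimit.
Context {k : class_sizes G} {e : nat -> edge (Gk k)} (eP : infinite_path e).

Definition initial_path n : fin_path Gk k n.+1 :=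
  exist _ (initial_tuple n.+1 e) ((infinite_pathP e).1 eP n).

Lemma path_limit_subproof :
  (fun n => path_pt (initial_path n)) \in
  [set x : forall n, approx_space Gk n.+1 |
    forall n, approx_proj (x n.+1) = x n].
Proof.
apply/mem_set => n /=; congr path_pt; apply: val_inj.
exact: trunc_initial_tuple.
Qed.

Definition path_limit : inverse_limit Gk :=
  exist (fun x => x \in _) _ path_limit_subproof.

End PathLimit.

Lemma path_pt_inj n k : injective (@path_pt _ _ Gk n k).
Proof.
by move=> p q [] /(@eq_from_Tagged (class_sizes G) (fun k => fin_path Gk k n)).
Qed.

(** The projections preserve the kind of a point and the index [k] of a path, so
    both are decided at the first level. *)
Lemma inverse_limitP (x : inverse_limit Gk) :
  (exists s, x = word_limit s) \/
  (exists k (e : nat -> edge (Gk k)) (eP : infinite_path e),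
     x = path_limit eP).
Proof.
have projx n : approx_proj (val x n.+1) = val x n by exact: limit_projE.
case x0: (val x 0) => [w|[k p]]; [left|right].
  have words : forall n, exists w, val x n = word_pt Gk w.
    elim=> [|n [w' xn]]; first by exists w.
    have := projx n; rewrite xn; case: (val x n.+1) => [v|[k p]] // _.
    by exists v.
  pose u n := sval (cid (words n)).
  have ux n : val x n = word_pt Gk (u n) := svalP (cid (words n)).
  have [n|s su] := @coherent_tuples _ u.
    by have := projx n; rewrite !ux => -[].
  exists s; apply: val_inj; apply: functional_extensionality_dep => n.
  by rewrite ux su.
have paths : forall n, exists q : fin_path Gk k n.+1, val x n = path_pt q.
  elim=> [|n [q xn]]; first by exists p.
  have := projx n; rewrite xn; case: (val x n.+1) => [//|[l r]] /= lk.
  have {}lk : l = k by case: lk.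
  by case: _ / lk r => r; exists r.
pose u n := sval (cid (paths n)).
have ux n : val x n = path_pt (u n) := svalP (cid (paths n)).
have [n|e ue] := @coherent_tuples _ (fun n => val (u n)).
  by have := projx n; rewrite !ux => /path_pt_inj <-.
have eP : infinite_path e.
  by apply/infinite_pathP => n; rewrite -ue; exact: valP (u n).
exists k, e, eP; apply: val_inj; apply: functional_extensionality_dep => n.
by rewrite ux; congr path_pt; apply: val_inj; exact: ue.
Qed.

Definition coordinate (k : class_sizes G) (e : nat -> edge (Gk k))
    (i : 'I_(val k)) : addr m :=
  fun n => tnth (lab (e n)) i.

Lemma accepted_coordinate k (e : nat -> edge (Gk k)) :
  infinite_path e -> accepted_tuple Gk (coordinate e).
Proof.
move=> eP; exists e => // n; apply: eq_from_tnth => i.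
by rewrite tnth_mktuple.
Qed.

Lemma path_limit_words k (e : nat -> edge (Gk k)) (eP : infinite_path e) n :
  point_words (limit_proj n (path_limit eP)) =
  range (fun i => initial_tuple n.+1 (coordinate e i)).
Proof.
apply: eq_imagel => i _; apply: eq_from_tnth => j.
by rewrite !tnth_mktuple.
Qed.

Definition address_of (x : inverse_limit Gk) (s : addr m) : Prop :=
  forall n, point_words (limit_proj n x) (initial_tuple n.+1 s).

Lemma address_of_word_limit s t : address_of (word_limit s) t -> t = s.
Proof.
move=> st; apply: funext => n.
by have /initial_tupleP := st n; apply; exact: ltnSn.
Qed.

Lemma nbhs_limitP (x : inverse_limit Gk) (A : set (inverse_limit Gk)) :
  nbhs x A <->
  exists n, forall z, min_nbhs (limit_proj n x) (limit_proj n z) -> A z.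
Proof. by split=> [[n _ nA]|[n nA]]; exists n. Qed.

Lemma word_limit_continuous : continuous word_limit.
Proof.
move=> s A /nbhs_limitP[n nA]; apply: filterS (nbhs_cylinder s n.+1) => t ts.
by apply: nA; apply: min_nbhs_word_pt; exact: ts.
Qed.

(** Each neighbourhood of [x] contains [word_limit s], so [f (word_limit s)]
    lies in each neighbourhood of [f x]. *)
Lemma address_of_limit (X : topologicalType) (f : inverse_limit Gk -> X) x s :
  hausdorff_space X -> continuous f -> address_of x s -> f x = f (word_limit s).
Proof.
move=> hX fc xs; apply: hX => A B fxA fsB.
have /nbhs_limitP[n nA] := fc x _ fxA.
exists (f (word_limit s)); split; last exact: nbhs_singleton.
apply: nA; exact: min_nbhs_word_pt.
Qed.

Context (complG : complete_tuple_automata Gk).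

(** The finite family [a] consists of the coordinates of [x].  It is kept along
    with the single address [s] because continuity of the projection to the
    generated space has to control all coordinates at once. *)
Lemma limit_addresses (x : inverse_limit Gk) :
  exists s, address_of x s /\
  exists k (a : 'I_k -> addr m), (forall i, addr_sim G s (a i)) /\
    forall n, point_words (limit_proj n x) `<=`
              range (fun i => initial_tuple n.+1 (a i)).
Proof.
case: (inverse_limitP x) => [[s ->]|[k [e [eP ->]]]].
  exists s; split=> //; exists 1, (fun=> s); split=> [i|n w /= ->].
    exact: rst_refl.
  by exists ord0.
have [_ acc _] := complG k.
have [/ltnW k0 _] := set_mem (valP k).
exists (coordinate e (Ordinal k0)); split.
  by move=> n; rewrite path_limit_words; exists (Ordinal k0).
exists (val k), (coordinate e).
split=> [i|n]; last by rewrite path_limit_words.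
exact: acc (accepted_coordinate eP) _ _.
Qed.

(** If [s] and [t] differ, their class has [k >= 2] elements, and the required
    point is the path along which [G_k] accepts the class. *)
Lemma sim_common_point s t :
  finite_set (addr_class G s) -> addr_sim G s t ->
  exists x, address_of x s /\ address_of x t.
Proof.
move=> /finite_setP[k sk] st.
have [->|ne] := EM (s = t); first by exists (word_limit t).
have k2 : (2 <= k)%N.
  rewrite (_ : 2 = size [:: s; t]) //; apply: (card_uniq_in_set sk).
    by rewrite /= inE andbT; apply/eqP.
  by move=> x; rewrite !inE => /orP[]/eqP ->; [exact: rst_refl|].
have Kk : k \in class_sizes G by apply/mem_set; split=> //; exists s.
pose kk : class_sizes G := exist _ k Kk.
have [_ _ compl] := complG kk.
have [a [_ ra [e eP ea]]] := compl s sk.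
have ae i : a i = coordinate e i.
  by apply: funext => n; rewrite /coordinate ea tnth_mktuple.
exists (path_limit eP).
suff addr_a r : addr_sim G s r -> address_of (path_limit eP) r.
  by split; apply: addr_a => //; exact: rst_refl.
rewrite -[addr_sim G s r]/(addr_class G s r) -ra => -[i _ <-] n.
by rewrite path_limit_words; exists i => //; rewrite ae.
Qed.

Lemma sim_word_limit (X : topologicalType) (f : inverse_limit Gk -> X) s t :
  hausdorff_space X -> continuous f ->
  finite_set (addr_class G s) -> addr_sim G s t ->
  f (word_limit s) = f (word_limit t).
Proof.
move=> hX fc fins st; have [x [xs xt]] := sim_common_point fins st.
by rewrite -(address_of_limit hX fc xs) (address_of_limit hX fc xt).
Qed.

(** For continuity at [x], an open set around [F x] contains the images of
    cylinders of some common length around all coordinates of [x]; if [z] is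
    close to [x] at that level, its address starts with a word of [x] and so
    lies in one of these cylinders. *)
Lemma limit_to_generated : exists F : inverse_limit Gk -> generated_space G,
  [/\ continuous F,
      forall s, F (word_limit s) = address_map G s &
      forall x, exists s, F x = address_map G s /\ address_of x s].
Proof.
have [sigma sigmaP] := choice limit_addresses.
exists (fun x => address_map G (sigma x)); split.
- move=> x V; have [_ [k [a [asim words]]]] := sigmaP x => Vx.
  have near_a i : exists n, forall t : addr m,
      initial_tuple n t = initial_tuple n (a i) -> V (address_map G t).
    apply: cylinder_basis; apply: address_map_continuous.
    by have /address_map_eq <- := asim i.
  have [d dP] := choice near_a.
  apply/nbhs_limitP; exists (\max_(i < k) d i) => z /min_nbhs_words zx.
  have [/(_ (\max_(i < k) d i)) sz _] := sigmaP z.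
  have [i _ /initial_tupleP ai] := words _ _ (zx _ sz).
  apply: (dP i); apply/initial_tupleP => j ltj; rewrite ai //.
  by rewrite ltnS ltnW //; apply: leq_trans ltj _; exact: leq_bigmax.
- move=> s; congr address_map; apply: address_of_word_limit.
  by case: (sigmaP (word_limit s)).
- by move=> x; exists (sigma x); split=> //; case: (sigmaP x).
Qed.

End InverseLimit.

(** * The associated Hausdorff space *)

Lemma hausdorff_quotientP (R : realType) (Y : topologicalType) (x y : Y) :
  \pi_(hausdorff_quotient R Y) x = \pi_(hausdorff_quotient R Y) y <->
  fun_sim R x y.
Proof.
pose e := prop_equiv (@fun_sim_equivalence R Y).
by split=> [/(@eqmodP _ e)/asboolP //|xy]; apply/(@eqmodP _ e)/asboolP.
Qed.

(** Continuous real functions descend to the quotient and separate its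
    points. *)
Lemma hausdorff_quotient_hausdorff (R : realType) (Y : topologicalType) :
  hausdorff_space (hausdorff_quotient R Y).
Proof.
move=> p q pq; rewrite -(reprK p) -(reprK q); apply/hausdorff_quotientP => f fc.
have fl : continuous (f \o repr : hausdorff_quotient R Y -> R).
  apply/quotient_continuous; rewrite (_ : _ \o _ = f) //.
  apply: funext => y /=; apply: ((hausdorff_quotientP R _ y).1 _ f fc).
  by rewrite reprK.
apply: (@Rhausdorff R) => A B fpA fqB.
have [z [zA zB]] := pq _ _ (fl p _ fpA) (fl q _ fqB).
by exists (f (repr z)).
Qed.

Theorem theorem7p2 (R : realType) (m : nat) (G : lgraph ('I_m * 'I_m))
  (Gk : forall k : class_sizes G, lgraph ((val k).-tuple 'I_m)) (C : nat) :
  generating_automaton G ->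
  (forall s : addr m, exists2 k : nat, (k < C)%N & addr_class G s #= `I_k) ->
  complete_tuple_automata Gk ->
  [/\ compact [set: hausdorff_quotient R (inverse_limit Gk)],
      hausdorff_space (hausdorff_quotient R (inverse_limit Gk)) &
      homeomorphic (generated_space G)
        (hausdorff_quotient R (inverse_limit Gk))].
Proof.
move=> autG finC complG.
have [F [Fc Fw Fa]] := limit_to_generated complG.
pose H := hausdorff_quotient R (inverse_limit Gk).
pose h (s : addr m) : H := \pi_H (word_limit Gk s).
have hc : continuous h.
  move=> s; apply: continuous_comp; first exact: word_limit_continuous.
  exact: pi_continuous.
have finS s : finite_set (addr_class G s).
  by have [k _ sk] := finC s; apply/finite_setP; exists k.
(* The fibres of [F] are exactly the classes that real functions identify. *)
have fun_simE x y : fun_sim R x y <-> F x = F y.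
  split=> [xy|Fxy f fc].
    apply: contrapT => /(generated_space_separation autG finC R)[f fc]; apply.
    by apply: (xy (f \o F)) => z; apply: continuous_comp; [exact: Fc|exact: fc].
  have [s [xs sx]] := Fa x; have [t [yt ty]] := Fa y.
  rewrite (address_of_limit (@Rhausdorff R) fc sx).
  rewrite (address_of_limit (@Rhausdorff R) fc ty).
  apply: (sim_word_limit complG (@Rhausdorff R) fc (finS s)).
  by apply/address_map_eq; rewrite -xs -yt.
have piE x y : \pi_H x = \pi_H y <-> F x = F y.
  by rewrite -fun_simE; exact: hausdorff_quotientP.
have hsurj p : exists s, h s = p.
  have [s [Fs _]] := Fa (repr p); exists s.
  by rewrite -[RHS]reprK; apply/piE; rewrite Fw Fs.
split.
- rewrite (_ : [set: _] = h @` setT).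
    apply: continuous_compact; first exact: continuous_subspaceT.
    exact: seq_space_compact.
  by apply/seteqP; split=> // p _; have [s <-] := hsurj p; exists s.
- exact: hausdorff_quotient_hausdorff.
exists (h \o repr), (F \o repr); split.
- move=> x /=; transitivity (F (word_limit Gk (repr x))).
    by apply/piE; rewrite reprK.
  by rewrite Fw /address_map reprK.
- move=> p /=; rewrite -[RHS]reprK; apply/piE.
  by rewrite Fw /address_map reprK.
- apply/quotient_continuous; rewrite (_ : _ \o _ = h) //.
  by apply: funext => s; apply/piE; rewrite !Fw; exact: reprK.
- apply/quotient_continuous; rewrite (_ : _ \o _ = F) //.
  by apply: funext => x; apply/piE; rewrite reprK.
Qed.
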